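(* Let $X$ be a set, let $\alpha\in\mathcal P_X$, and suppose the kernel-classes of $\alpha$ are $X_i$ ($i\in I$). Then $\alpha$ is an idempotent (that is, $\alpha^2=\alpha$) if and only if the following two conditions are satisfied: (i) $\alpha\in\bigoplus_{i\in I}\mathcal P_{X_i}$, and (ii) the restrictions $\alpha|_{X_i}$ ($i\in I$) all have rank at most $1$.
   Context: Let $X$ be a set (finite or infinite) and $X'=\{x':x\in X\}$ a disjoint copy of $X$. A partition on $X$ is a collection of pairwise disjoint non-empty subsets (blocks) of $X\cup X'$ whose union is $X\cup X'$; $\mathcal P_X$ is the set of all of these. A partition is identified with any graph on $X\cup X'$ whose connected components are its blocks. Product: for $\alpha,\beta\in\mathcal P_X$ take a third disjoint copy $X''=\{x'':x\in X\}$ of $X$; relabel each lower vertex $x'$ of $\alpha$ as $x''$ and each upper vertex $x$ of $\beta$ as $x''$, and let $\Gamma(\alpha,\beta)$ be the graph on $X\cup X'\cup X''$ obtained as the union of the two resulting graphs. Then $\alpha\beta\in\mathcal P_X$ is the partition in which $x,y\in X\cup X'$ lie in the same block iff there is a path from $x$ to $y$ in $\Gamma(\alpha,\beta)$. This makes $\mathcal P_X$ a monoid. For $x\in X\cup X'$, $[x]_\alpha$ is the block of $\alpha$ containing $x$. The upper and lower kernels of $\alpha$ are the equivalences on $X$ given by $\ker^\wedge(\alpha)=\{(x,y):[x]_\alpha=[y]_\alpha\}$ and $\ker_\vee(\alpha)=\{(x,y):[x']_\alpha=[y']_\alpha\}$. The kernel of $\alpha$ is $\ker(\alpha)=\ker^\wedge(\alpha)\vee\ker_\vee(\alpha)$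 (the smallest equivalence on $X$ containing both), and its equivalence classes are the kernel-classes of $\alpha$. The rank of $\alpha$ is the number of blocks of $\alpha$ meeting both $X$ and $X'$. If $X$ is the disjoint union of sets $X_i$ ($i\in I$), then $\bigoplus_{i\in I}\mathcal P_{X_i}$ is the set of $\alpha\in\mathcal P_X$ such that each block of $\alpha$ is contained in $X_i\cup X_i'$ for some $i\in I$; for such $\alpha$, the restriction is $\alpha|_{X_i}=\{A\in\alpha: A\subseteq X_i\cup X_i'\}\in\mathcal P_{X_i}$. *)

(* Defs.v *)
From Stdlib Require Export Relation_Definitions Relation_Operators.
From mathcomp Require Export all_boot.
From mathcomp Require Export boolp classical_sets functions cardinality.

Set Implicit Arguments.
Unset Strict Implicit.
Unset Printing Implicit Defensive.

Local Open Scope classical_set_scope.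
Local Open Scope card_scope.

(* The disjoint union of X and its copy X' is [X + X]: [inl x] stands for x
   and [inr x] for x'.  [dbl D] is the union of D and D'. *)
Definition dbl (X : Type) (D : set X) : set (X + X) := inl @` D `|` inr @` D.

Definition is_partition_on (X : Type) (D : set X) (P : set (set (X + X))) :=
  partition P id (dbl D).

Record PX (X : Type) := Partition {
  blocks : set (set (X + X));
  blocksP : is_partition_on [set: X] blocks }.

Definition block (X : Type) (alpha : PX X) (u : X + X) : set (X + X) :=
  \bigcup_(A in [set A | blocks alpha A /\ A u]) A.

(* Vertices of the product graph: [inl (inl x)], [inl (inr x)] and [inr x] are
   x, x' and x'' respectively. *)
Definition vertex (X : Type) := ((X + X) + X)%type.

Definition lower_to_middle (X : Type) (u : X + X) : vertex X :=
  match u with inl x => inl (inl x) | inr x => inr x end.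

Definition upper_to_middle (X : Type) (u : X + X) : vertex X :=
  match u with inl x => inr x | inr x => inl (inr x) end.

(* Each partition is represented by the graph in which every block is a
   complete graph (with loops). *)
Inductive Gamma (X : Type) (alpha beta : PX X) : vertex X -> vertex X -> Prop :=
| Gamma_left A u v : blocks alpha A -> A u -> A v ->
    Gamma alpha beta (lower_to_middle u) (lower_to_middle v)
| Gamma_right A u v : blocks beta A -> A u -> A v ->
    Gamma alpha beta (upper_to_middle u) (upper_to_middle v).

Definition joined (X : Type) (alpha beta : PX X) (u v : X + X) : Prop :=
  clos_refl_trans (vertex X) (Gamma alpha beta) (inl u) (inl v).

Definition product_blocks (X : Type) (alpha beta : PX X) : set (set (X + X)) :=
  range (fun u => [set v | joined alpha beta u v]).

Lemma dblT (X : Type) : dbl [set: X] = [set: X + X].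
Proof.
by apply/seteqP; split=> // -[x|x] _; [left; exists x | right; exists x].
Qed.

Lemma joined_sym (X : Type) (alpha beta : PX X) (u v : X + X) :
  joined alpha beta u v -> joined alpha beta v u.
Proof.
rewrite /joined; elim=> [p q []||p q r _ qp _ rq].
- by move=> A a b hA ha hb; apply: rt_step; apply: Gamma_left hA hb ha.
- by move=> A a b hA ha hb; apply: rt_step; apply: Gamma_right hA hb ha.
- by move=> p; apply: rt_refl.
- exact: rt_trans rq qp.
Qed.

Lemma product_partition (X : Type) (alpha beta : PX X) :
  is_partition_on [set: X] (product_blocks alpha beta).
Proof.
rewrite /is_partition_on dblT; split.
- apply/seteqP; split=> // u _.
  exists [set v | joined alpha beta u v]; last exact: rt_refl.
  by exists u.
- move=> _ _ [u _ <-] [v _ <-] [w [/= uw vw]].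
  have uv : joined alpha beta u v by apply: rt_trans uw (joined_sym vw).
  apply/seteqP; split=> t /= ht; last exact: rt_trans uv ht.
  exact: rt_trans (joined_sym uv) ht.
- by move=> _ [u _ <-]; exists u; apply: rt_refl.
Qed.

Definition mul (X : Type) (alpha beta : PX X) : PX X :=
  Partition (product_partition alpha beta).

Definition upper_kernel (X : Type) (alpha : PX X) : set (X * X) :=
  [set xy | block alpha (inl xy.1) = block alpha (inl xy.2)].

Definition lower_kernel (X : Type) (alpha : PX X) : set (X * X) :=
  [set xy | block alpha (inr xy.1) = block alpha (inr xy.2)].

Definition is_equiv (X : Type) (E : set (X * X)) : Prop :=
  equivalence X (fun x y => E (x, y)).

Definition kernel (X : Type) (alpha : PX X) : set (X * X) :=
  smallest (@is_equiv X) (upper_kernel alpha `|` lower_kernel alpha).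

Definition kernel_classes (X : Type) (alpha : PX X) : set (set X) :=
  range (fun x => [set y | kernel alpha (x, y)]).

Definition direct_sum (X I : Type) (Xi : I -> set X) : set (PX X) :=
  [set alpha | forall A, blocks alpha A -> exists i, A `<=` dbl (Xi i)].

Definition restriction (X : Type) (alpha : PX X) (D : set X) :
    set (set (X + X)) :=
  [set A | blocks alpha A /\ A `<=` dbl D].

Definition transversals (X : Type) (P : set (set (X + X))) :
    set (set (X + X)) :=
  [set A | [/\ P A, A `&` range inl !=set0 & A `&` range inr !=set0]].

(* The rank is the cardinality of [transversals P], possibly infinite; only its
   comparison with a natural number is needed. *)
Definition rank_le (X : Type) (P : set (set (X + X))) (n : nat) : Prop :=
  transversals P #<= `I_n.

Lemma PX_eq (X : Type) (alpha beta : PX X) :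
  blocks alpha = blocks beta -> alpha = beta.
Proof.
case: alpha beta => [a ha] [b hb] /= ab.
by case: _ / ab hb => hb; rewrite (Prop_irrelevance ha hb).
Qed.

Lemma block_in (X : Type) (alpha : PX X) (u : X + X) :
  blocks alpha (block alpha u) /\ block alpha u u.
Proof.
have [hc ht _] := blocksP alpha; rewrite dblT in hc.
have [A hA Au] : cover (blocks alpha) id u by rewrite hc.
suff -> : block alpha u = A by [].
apply/seteqP; split=> [v [B [hB Bu] Bv]|v Av]; last by exists A.
by rewrite -(ht B A hB hA) //; exists u.
Qed.

Lemma restriction_partition (X I : Type) (Xi : I -> set X) (alpha : PX X)
    (i : I) :
  trivIset [set: I] Xi -> direct_sum Xi alpha ->
  is_partition_on (Xi i) (restriction alpha (Xi i)).
Proof.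
move=> tX ds; have [_ ht hn] := blocksP alpha.
split; [|by move=> A B [hA _] [hB _]; exact: ht|by move=> A [/hn]].
apply/seteqP; split=> [u [A [_ AX] Au]|u Xu]; first exact: AX.
have [hb bu] := block_in alpha u; have [j bj] := ds _ hb.
exists (block alpha u) => //; split=> //.
suff -> : i = j by [].
apply: tX => //.
by case: Xu (bj _ bu) => -[x Xx <-] [] [y Xy] // [yx]; exists x; split=> //;
  rewrite -yx.
Qed.

(* Main.v *)
Require Import Defs.
From Stdlib Require Import Operators_Properties.
Local Open Scope classical_set_scope.

(** Write x K y when x and y lie in the same kernel-class of [alpha].

    The middle row of the product graph of [alpha] with itself carries the
    lower kernel of the left factor and the upper kernel of the right factor,
    so all the vertices x'' of one kernel-class are connected through the
    middle row alone ([kernel_path]).  A step between an outer vertex and a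
    middle vertex, on the other hand, is exactly an instance of a transversal
    block of [alpha] ([Gamma_step]).  The theorem results from playing these
    two facts against each other.

    The two conditions are first rephrased for elements.  Condition (i) says
    that vertices in the same block have base points in the same kernel-class
    ([direct_sum_linkedP]); condition (ii) says that two transversal blocks
    over the same kernel-class coincide, once (i) holds ([rank_le1_crosses]).

    Suppose that [alpha] is idempotent.  If x and y' are in one block, there is
    a path from x to y' in the product graph, and it enters the lower row for
    the first time from some w''.  Before that it meets only top vertices, all
    in the block of x by idempotency, and middle vertices, all K-related to y:
    the middle row is entered at some z'' with z' in the block of x and y',
    hence z K y, and is then followed inside one kernel-class, so w K y.  The
    block of w contains a bottom vertex that is joined to x, so by idempotency
    x and w are in one block, and x K w K y, which is (i).  If A and B are
    transversal blocks over one kernel-class, then a path goes from the top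
    part of A to the middle row, along it, and down to the bottom part of B;
    hence A = B, which is (ii).

    Conversely, by (i) a path in the product graph never leaves the
    kernel-class where it starts, and whenever it leaves or enters the middle
    row it does so through the unique transversal block available there by
    (ii); so the outer vertices on the path all lie in one block.  And if x and
    y' are in one block, then x K y by (i), so x and y' are joined by going
    down to y'', along to x'', and down to y'. *)

Set Implicit Arguments.
Unset Strict Implicit.
Unset Printing Implicit Defensive.

(** * Blocks and the kernel *)

Definition linked (X : Type) (alpha : PX X) (u v : X + X) : Prop :=
  block alpha u = block alpha v.

Definition base (X : Type) (u : X + X) : X :=
  match u with inl x => x | inr x => x end.

(** The copy of z in the row opposite to u.  An edge of the product graph
    between an outer vertex u and z'' comes from u and [across u z] being in
    one block, whichever row u is in. *)
Definition across (X : Type) (u : X + X) (z : X) : X + X :=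
  match u with inl _ => inr z | inr _ => inl z end.

(** The block of u is transversal. *)
Definition crosses (X : Type) (alpha : PX X) (u : X + X) : Prop :=
  exists z, linked alpha u (across u z).

Lemma block_eq (X : Type) (alpha : PX X) (A : set (X + X)) (u : X + X) :
  blocks alpha A -> A u -> A = block alpha u.
Proof.
move=> hA Au; have [_ ht _] := blocksP alpha.
by have [hB Bu] := block_in alpha u; apply: ht => //; exists u.
Qed.

Lemma linkedP (X : Type) (alpha : PX X) (u v : X + X) :
  linked alpha u v <-> block alpha u v.
Proof.
split=> [uv|uv]; first by rewrite uv; have [] := block_in alpha v.
by apply: block_eq uv; have [] := block_in alpha u.
Qed.

Lemma linked_in_block (X : Type) (alpha : PX X) (A : set (X + X)) u v :
  blocks alpha A -> A u -> A v -> linked alpha u v.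
Proof. by move=> hA Au Av; rewrite /linked -!(block_eq hA). Qed.

Lemma block_nonempty (X : Type) (alpha : PX X) (A : set (X + X)) :
  blocks alpha A -> exists u, A u.
Proof. by move=> hA; have [_ _ /(_ A hA)] := blocksP alpha. Qed.

Lemma PX_eq_linked (X : Type) (alpha beta : PX X) :
  (forall u v, linked alpha u v <-> linked beta u v) -> alpha = beta.
Proof.
move=> h; have hb u : block alpha u = block beta u.
  by apply/seteqP; split=> v /linkedP/h/linkedP.
apply: PX_eq; apply/seteqP; split=> A hA; have [u Au] := block_nonempty hA.
  by rewrite (block_eq hA Au) hb; have [] := block_in beta u.
by rewrite (block_eq hA Au) -hb; have [] := block_in alpha u.
Qed.

Lemma linked_mul (X : Type) (alpha beta : PX X) (u v : X + X) :
  linked (mul alpha beta) u v <-> joined alpha beta u v.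
Proof.
rewrite linkedP -(@block_eq _ _ [set w | joined alpha beta u w] u) //=.
  by exists u.
exact: rt_refl.
Qed.

Lemma idempotentP (X : Type) (alpha : PX X) :
  mul alpha alpha = alpha <->
  forall u v, joined alpha alpha u v <-> linked alpha u v.
Proof.
split=> [h u v|h]; first by rewrite -linked_mul h.
by apply: PX_eq_linked => u v; rewrite linked_mul.
Qed.

Lemma across_base (X : Type) (u v : X + X) :
  is_inl u = is_inl v \/ v = across u (base v).
Proof. by case: u v => [x|x] [y|y]; [left|right|right|left]. Qed.

Lemma crosses_linked (X : Type) (alpha : PX X) (u v : X + X) :
  linked alpha u v -> crosses alpha v -> crosses alpha u.
Proof.
move=> uv [z vz]; have [suv|vu] := across_base u v; last first.
  by exists (base v); rewrite -vu.
by exists z; move: uv vz suv; case: u v => [x|x] [y|y] //=;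
  rewrite /linked => ->.
Qed.

Lemma kernel_equiv (X : Type) (alpha : PX X) : is_equiv (kernel alpha).
Proof.
split=> [x M [[] ]|x y z xy yz M hM|x y xy M hM].
- by move=> + _ _ _; apply.
- by have [[_ tM _] _] := hM; apply: tM (xy M hM) (yz M hM).
- by have [[_ _ sM] _] := hM; apply: sM (xy M hM).
Qed.

Lemma kernel_refl (X : Type) (alpha : PX X) x : kernel alpha (x, x).
Proof. by have [r _ _] := kernel_equiv alpha; apply: r. Qed.

Lemma kernel_trans (X : Type) (alpha : PX X) x y z :
  kernel alpha (x, y) -> kernel alpha (y, z) -> kernel alpha (x, z).
Proof. by have [_ t _] := kernel_equiv alpha; apply: t. Qed.

Lemma kernel_sym (X : Type) (alpha : PX X) x y :
  kernel alpha (x, y) -> kernel alpha (y, x).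
Proof. by have [_ _ s] := kernel_equiv alpha; apply: s. Qed.

Lemma linked_same_side_kernel (X : Type) (alpha : PX X) u v :
  is_inl u = is_inl v -> linked alpha u v -> kernel alpha (base u, base v).
Proof.
move=> suv uv; apply: sub_gen_smallest.
by move: u v suv uv => [x|x] [y|y] // _ uv; [left|right].
Qed.

(** * The product graph of a partition with itself *)

(** The factor that an edge comes from need not be remembered: z'' stands for
    z' in the left factor, whose outer row is the top one, and for z in the
    right factor, whose outer row is the bottom one.  So seen from an outer
    vertex, z'' always stands for the copy of z in the opposite row. *)
Lemma Gamma_step (X : Type) (alpha : PX X) (p q : vertex X) :
  Gamma alpha alpha p q ->
  match p, q with
  | inl u, inl v => is_inl u = is_inl v /\ linked alpha u v
  | inl u, inr z | inr z, inl u => linked alpha u (across u z)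
  | inr z, inr w => kernel alpha (z, w)
  end.
Proof.
by case=> A [x|x] [y|y] hA Ax Ay /=;
  have xy := linked_in_block hA Ax Ay;
  rewrite //; by [exact: (linked_same_side_kernel _ xy)|exact: esym].
Qed.

Lemma kernel_path (X : Type) (alpha : PX X) x y :
  kernel alpha (x, y) ->
  clos_refl_trans (vertex X) (Gamma alpha alpha) (inr x) (inr y).
Proof.
pose M := [set xy : X * X | clos_refl_trans (vertex X) (Gamma alpha alpha)
    (inr xy.1) (inr xy.2) /\
  clos_refl_trans (vertex X) (Gamma alpha alpha) (inr xy.2) (inr xy.1)].
suff: kernel alpha `<=` M by move=> /[apply]-[].
apply: smallest_sub.
  split=> [z|a b c [ab ba] [bc cb]|a b []] //.
  - by split; apply: rt_refl.
  - by split; [apply: rt_trans ab bc|apply: rt_trans cb ba].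
(* The middle row of the left factor is its lower row, that of the right factor
   is its upper row. *)
case=> a b [|] /= /linkedP ab; split; apply: rt_step.
- have [hA Aa] := block_in alpha (inl a); exact: (Gamma_right _ hA Aa ab).
- have [hA Aa] := block_in alpha (inl a); exact: (Gamma_right _ hA ab Aa).
- have [hA Aa] := block_in alpha (inr a); exact: (Gamma_left _ hA Aa ab).
- have [hA Aa] := block_in alpha (inr a); exact: (Gamma_left _ hA ab Aa).
Qed.

Lemma Gamma_linked_left (X : Type) (alpha beta : PX X) u v :
  linked alpha u v ->
  Gamma alpha beta (lower_to_middle u) (lower_to_middle v).
Proof.
move=> /linkedP uv; have [hA Au] := block_in alpha u.
exact: Gamma_left hA Au uv.
Qed.

Lemma Gamma_linked_right (X : Type) (alpha beta : PX X) u v :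
  linked beta u v ->
  Gamma alpha beta (upper_to_middle u) (upper_to_middle v).
Proof.
move=> /linkedP uv; have [hA Au] := block_in beta u.
exact: Gamma_right hA Au uv.
Qed.

(** One can pass from the top row to the bottom row over a kernel-class as soon
    as one can enter and leave its middle row; the exit and the entrance need
    not be above each other. *)
Lemma joined_through_kernel (X : Type) (alpha : PX X) x z w y :
  linked alpha (inl x) (inr z) -> kernel alpha (z, w) ->
  linked alpha (inl w) (inr y) -> joined alpha alpha (inl x) (inr y).
Proof.
move=> xz zw wy; apply: rt_trans (rt_step _ _ _ _ (Gamma_linked_left _ xz)) _.
apply: rt_trans (kernel_path zw) (rt_step _ _ _ _ _).
exact: (Gamma_linked_right _ wy).
Qed.

(** * The two conditions in terms of elements *)

Section Conditions.
Variables (X : Type) (alpha : PX X) (I : Type) (Xi : I -> set X).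
Hypothesis Xi_classes : range Xi = kernel_classes alpha.

Lemma dbl_base (D : set X) (u : X + X) : dbl D u <-> D (base u).
Proof.
split=> [[] [x Dx <-] //|]; case: u => x Dx; first by left; exists x.
by right; exists x.
Qed.

Lemma class_kernel i x y : Xi i x -> Xi i y -> kernel alpha (x, y).
Proof.
have [z _ <-] : kernel_classes alpha (Xi i) by rewrite -Xi_classes; exists i.
by move=> /= zx zy; apply: kernel_trans (kernel_sym zx) zy.
Qed.

Lemma kernel_class x :
  exists i, Xi i x /\ forall y, kernel alpha (x, y) -> Xi i y.
Proof.
have [i _ iE] : range Xi [set y | kernel alpha (x, y)].
  by rewrite Xi_classes; exists x.
by exists i; rewrite iE; split; first exact: kernel_refl.
Qed.

Lemma direct_sum_linkedP :
  direct_sum Xi alpha <->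
  forall u v, linked alpha u v -> kernel alpha (base u, base v).
Proof.
split=> [ds u v /linkedP uv|h A hA].
  have [hA Au] := block_in alpha u; have [i Ai] := ds _ hA.
  by apply: (@class_kernel i); apply/dbl_base; apply: Ai.
have [u Au] := block_nonempty hA; have [i [_ hi]] := kernel_class (base u).
exists i => v Av; apply/dbl_base; apply: hi; apply: h.
exact: linked_in_block hA Au Av.
Qed.

Lemma rank_le1_subset1 (P : set (set (X + X))) :
  rank_le P 1 <-> is_subset1 (transversals P).
Proof.
rewrite /rank_le; split=> [/pcard_leP[f] A B hA hB|h].
  apply: (@inj _ _ _ f); rewrite ?inE //.
  have := @funS _ _ _ _ f A hA; have := @funS _ _ _ _ f B hB.
  by rewrite /= !ltnS !leqn0 => /eqP -> /eqP ->.
have [[A hA]|nA] := pselect (exists A, transversals P A).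
  rewrite -(card_le_eqr (@card_set1 _ A)).
  by apply: subset_card_le => B hB; apply: h.
suff -> : transversals P = set0 by apply: card_ge0.
by apply/seteqP; split=> // A hA; case: nA; exists A.
Qed.

(** Condition (i) is needed to turn K-related base points into membership in
    one restriction: without it, a transversal block could fail to lie over a
    single kernel-class, and no restriction would count it. *)
Lemma rank_le1_crosses :
  direct_sum Xi alpha ->
  (forall i, rank_le (restriction alpha (Xi i)) 1) <->
  (forall u v, kernel alpha (base u, base v) ->
     crosses alpha u -> crosses alpha v -> linked alpha u v).
Proof.
move=> ds; have dk := (direct_sum_linkedP.1 ds); split=> [h u v uv cu cv|h i].
  have [i [iu hi]] := kernel_class (base u).
  have T w : kernel alpha (base u, base w) -> crosses alpha w ->
      transversals (restriction alpha (Xi i)) (block alpha w).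
    move=> uw [z wz]; have [hw ww] := block_in alpha w.
    have wz' := (linkedP _ _ _).1 wz; split.
    - split=> // t /linkedP wt; apply/dbl_base/hi; apply: kernel_trans uw _.
      exact: dk.
    - by case: w {uw wz hw} ww wz' => x ww wz; [exists (inl x)|exists (inl z)];
        split=> //; eexists.
    - by case: w {uw wz hw} ww wz' => x ww wz; [exists (inr z)|exists (inr x)];
        split=> //; eexists.
  by apply: ((rank_le1_subset1 _).1 (h i)); apply: T => //; exact: kernel_refl.
apply/rank_le1_subset1 => A B.
move=> [[hA Ai] [a [Ax [x _ xa]]] [b [Ay [y _ yb]]]].
move=> [[hB Bi] [c [Bz [z _ zc]]] [d [Bw [w _ wd]]]].
subst a b c d.
rewrite (block_eq hA Ax) (block_eq hB Bz); apply: h.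
- by apply: (@class_kernel i); apply/dbl_base; [apply: Ai|apply: Bi].
- by exists y; apply: linked_in_block hA _ _.
- by exists w; apply: linked_in_block hB _ _.
Qed.

End Conditions.

(** * Idempotents *)

Section Idempotent.
Variables (X : Type) (alpha : PX X).
Hypothesis idem : forall u v, joined alpha alpha u v <-> linked alpha u v.

(** The invariant along a path from x: until the bottom row is reached, its
    middle vertices are K-related to y; once it is reached, x K y holds for
    good. *)
Lemma idempotent_transversal_kernel x y :
  linked alpha (inl x) (inr y) -> kernel alpha (x, y).
Proof.
move=> xy; have xy_path := clos_rt_rtn1 _ _ _ _ ((idem _ _).2 xy).
pose P (q : vertex X) := kernel alpha (x, y) \/ match q with
  | inl v => is_inl v : Prop | inr z => kernel alpha (z, y) end.
suff /(_ _ xy_path)[] : forall q, clos_refl_trans_n1 (vertex X)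
  (Gamma alpha alpha) (inl (inl x)) q -> P q by [].
move=> q; elim=> [|p {}q pq xp [|Pp]]; [by right|by left|].
have {}xp := clos_rtn1_rt _ _ _ _ xp.
have xq := rt_trans _ _ _ _ _ xp (rt_step _ _ _ _ pq).
move: pq xp xq Pp => /Gamma_step; rewrite /P.
case: p q => [u|z] [v|w].
- by move=> [-> _] _ _; right.
- case: u => // u uw xu _ _; right; have {}xu := (idem _ _).1 xu.
  apply: (@linked_same_side_kernel _ _ (inr w) (inr y)) => //.
  by rewrite /linked -xy xu.
- case: v => v vz _ xv zy; first by right.
  left; apply: kernel_trans zy.
  apply: (@linked_same_side_kernel _ _ (inl x) (inl z)) => //.
  by rewrite /linked ((idem _ _).1 xv).
- by move=> zw _ _ zy; right; apply: kernel_trans (kernel_sym zw) zy.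
Qed.

Lemma idempotent_linked_kernel u v :
  linked alpha u v -> kernel alpha (base u, base v).
Proof.
case: u v => [x|x] [y|y] xy; try exact: (linked_same_side_kernel _ xy).
  exact: idempotent_transversal_kernel.
by apply: kernel_sym; apply: idempotent_transversal_kernel.
Qed.

Lemma crosses_vertical u :
  crosses alpha u ->
  exists x y, linked alpha u (inl x) /\ linked alpha u (inr y).
Proof. by case: u => a [z az]; [exists a, z|exists z, a]. Qed.

(** The path constructed goes from the top part of the block of u to the bottom
    part of the block of v. *)
Lemma idempotent_crosses u v :
  kernel alpha (base u, base v) ->
  crosses alpha u -> crosses alpha v -> linked alpha u v.
Proof.
move=> uv /crosses_vertical[x [y [ux uy]]] /crosses_vertical[z [w [vz vw]]].
have xw : joined alpha alpha (inl x) (inr w).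
  apply: (@joined_through_kernel _ _ _ y z); rewrite /linked -?ux -?vz //.
  apply: kernel_trans (kernel_sym (idempotent_linked_kernel uy)) _.
  exact: kernel_trans uv (idempotent_linked_kernel vz).
by move/idem: xw => xw; rewrite /linked ux vw.
Qed.

End Idempotent.

Section Converse.
Variables (X : Type) (alpha : PX X).
Hypothesis linked_kernel :
  forall u v, linked alpha u v -> kernel alpha (base u, base v).
Hypothesis crosses_unique : forall u v, kernel alpha (base u, base v) ->
  crosses alpha u -> crosses alpha v -> linked alpha u v.

Lemma linked_across_kernel u v z :
  linked alpha u (across v z) -> kernel alpha (base u, z).
Proof. by move=> /linked_kernel; case: v. Qed.

(** The invariant along a path from u: its outer vertices are in the block of
    u, and it meets the middle row only if that block is transversal, and then
    over the kernel-class of u. *)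
Lemma joined_linked u v : joined alpha alpha u v -> linked alpha u v.
Proof.
pose P (q : vertex X) := match q with
  | inl v => linked alpha u v
  | inr z => kernel alpha (base u, z) /\ crosses alpha u end.
move=> uv; suff: P (inl v) by [].
elim: (clos_rt_rtn1 _ _ _ _ uv) => [//|[a|z] [b|w] pq _];
  move: (Gamma_step pq); rewrite /P.
- by move=> [_ ab] ua; rewrite /linked ua.
- move=> aw ua; split; last by apply: crosses_linked ua _; exists w.
  by apply: (@linked_across_kernel _ a); rewrite /linked ua.
- move=> bz [uz cu]; apply: crosses_unique => //; last by exists z.
  exact: kernel_trans uz (kernel_sym (linked_across_kernel bz)).
- by move=> zw [uz cu]; split=> //; apply: kernel_trans zw.
Qed.

Lemma linked_joined u v : linked alpha u v -> joined alpha alpha u v.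
Proof.
have T x y : linked alpha (inl x) (inr y) ->
    joined alpha alpha (inl x) (inr y).
  move=> xy; apply: (joined_through_kernel xy _ xy).
  exact: kernel_sym (linked_kernel xy).
case: u v => [x|x] [y|y] xy.
- exact: rt_step (Gamma_linked_left _ xy).
- exact: T.
- by apply/joined_sym/T.
- exact: rt_step (Gamma_linked_right _ xy).
Qed.

End Converse.

Theorem theorem5 (X : Type) (alpha : PX X) (I : Type) (Xi : I -> set X)
    (Xi_inj : injective Xi)
    (Xi_classes : range Xi = kernel_classes alpha) :
  mul alpha alpha = alpha <->
  direct_sum Xi alpha /\ (forall i : I, rank_le (restriction alpha (Xi i)) 1).
Proof.
rewrite idempotentP; split=> [idem|[ds rk] u v].
  have ds : direct_sum Xi alpha.
    apply/(direct_sum_linkedP Xi_classes); exact: idempotent_linked_kernel.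
  split=> //; apply/(rank_le1_crosses Xi_classes ds).
  exact: idempotent_crosses.
have lk := (direct_sum_linkedP Xi_classes).1 ds.
have cu := (rank_le1_crosses Xi_classes ds).1 rk.
by split; [apply: joined_linked|apply: linked_joined].
Qed.
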